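(* Let $p>5$ be a prime and $a\in\mathbb Z_p$ with $a\not\equiv0,\pm1,\pm2,-3\pmod p$. Then $$\sum_{k=0}^{p-4}\binom ak\binom{-1-a}k\binom{2k}k\frac1{4^k(k+3)}\equiv\frac{3a(a+1)-10}{15(a-1)(a+2)}S_p(a)+\frac{(a+1)(3a(a+1)-16)}{15a(a-2)(a+3)}S_p(a+1)$$ $$\equiv\frac{28-6a(a+1)}{15(a-1)(a^2-4)(a+3)}S_p(a)+\frac{3a(a+1)-16}{15(a-2)(a+3)}\sum_{k=0}^{p-2}\binom ak\binom{-1-a}k\binom{2k}k\frac1{4^k(k+1)}\pmod{p^3}.$$
   Context: For a prime $p$, $\mathbb Z_p$ denotes the set of rational numbers whose denominator is not divisible by $p$, and congruences modulo powers of $p$ are between elements of $\mathbb Z_p$ (the difference divided by that power of $p$ lies in $\mathbb Z_p$). For rational $a$ and integer $k\ge0$, $\binom ak=a(a-1)\cdots(a-k+1)/k!$. Define $S_n(a)=\sum_{k=0}^{n-1}\binom ak\binom{-1-a}k\binom{2k}k\frac1{4^k}$ for $n\ge1$. *)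

(* Defs.v *)
From mathcomp Require Import all_boot all_order all_algebra.

Set Implicit Arguments.
Unset Strict Implicit.
Unset Printing Implicit Defensive.

Import Order.TTheory GRing.Theory Num.Theory.
Local Open Scope ring_scope.

(* The local ring Z_p (rationals, not p-adic completion); denq is the
   denominator in lowest terms. *)
Definition in_Zp (p : nat) (x : rat) : bool := ~~ (p %| `|denq x|)%N.

(* x == y (mod p^r) in Z_p *)
Definition congZp (p r : nat) (x y : rat) : bool :=
  in_Zp p ((x - y) / p%:R ^+ r).

(* The generalized binomial coefficient a(a-1)...(a-k+1)/k! for rational a. *)
Definition qbinom (a : rat) (k : nat) : rat :=
  (\prod_(i < k) (a - i%:R)) / k`!%:R.

Definition S_term (a : rat) (k : nat) : rat :=
  qbinom a k * qbinom (- 1 - a) k * 'C(2 * k, k)%:R / 4 ^+ k.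

Definition S_sum (n : nat) (a : rat) : rat :=
  \sum_(0 <= k < n) S_term a k.

(* Main.v *)
Require Import Defs.
From mathcomp Require Import all_boot all_order all_algebra.
From mathcomp Require Import ring zify.
Import Order.TTheory GRing.Theory Num.Theory.
Local Open Scope ring_scope.

(** Write [m = a (a + 1)] and [t_k] for the summand [S_term a k].  The term ratio
    [t_(k+1) / t_k] is a rational function of [k], and Gosper summation gives two
    identities over the rationals, valid for every upper bound: one expresses
    [sum t_k / (k + 1)] through [sum t_k(a)] and [sum t_k(a + 1)], the other
    expresses [sum t_k / (k + 3)] through [sum t_k] and [sum t_k / (k + 1)],
    each up to a rational multiple of a single boundary term [t_n].
    The conditions on [a] mod [p] say that each of the three binomial factors of
    [t_(p-3)], [t_(p-2)], [t_(p-1)] (and of the last term of [S_p(a + 1)]) is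
    divisible by [p], so these terms, and with them all boundary contributions,
    vanish mod [p^3]. *)

(** * Binomial recurrences and term ratios *)

Lemma qbinom0 b : qbinom b 0 = 1.
Proof. by rewrite /qbinom big_ord0 fact0 divr1. Qed.

Lemma qbinomS b k : qbinom b k.+1 = qbinom b k * (b - k%:R) / k.+1%:R.
Proof.
rewrite /qbinom big_ord_recr /= factS natrM invfM; ring.
Qed.

Lemma qbinomDS b k : qbinom (b + 1) k.+1 = (b + 1) / k.+1%:R * qbinom b k.
Proof.
rewrite /qbinom big_ord_recl /= subr0 factS natrM invfM.
have -> : \prod_(i < k) (b + 1 - (lift ord0 i)%:R) = \prod_(i < k) (b - i%:R).
  by apply: eq_bigr => i _; rewrite lift0 -natr1; ring.
ring.
Qed.

(** Both sides are [k.+1] times [qbinom b k.+1], expanded once by [qbinomDS] at [b - 1] and once by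
    [qbinomS]. *)
Lemma qbinom_pred b k : b * qbinom (b - 1) k = (b - k%:R) * qbinom b k.
Proof.
have := qbinomDS (b - 1) k; rewrite subrK qbinomS => e.
have k0 : k.+1%:R != 0 :> rat by rewrite pnatr_eq0.
apply: (mulIf (invr_neq0 k0)).
rewrite mulrAC -e; ring.
Qed.

Lemma S_term0 a : S_term a 0 = 1.
Proof. by rewrite /S_term !qbinom0 bin0 expr0 divr1 !mulr1. Qed.

Lemma bin_central_rec k :
  'C(2 * k.+1, k.+1)%:R = 2 * (2 * k%:R + 1) / k.+1%:R * 'C(2 * k, k)%:R :> rat.
Proof.
have k0 : k.+1%:R != 0 :> rat by rewrite pnatr_eq0.
(* Both identities involve ['C((2 * k).+1, k)], which is then eliminated. *)
have e1 := mul_bin_diag (2 * k).+2 k.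
have e2 := mul_bin_down (2 * k).+1 k.
have e : (k.+1 * 'C(2 * k.+1, k.+1) = 2 * (2 * k + 1) * 'C(2 * k, k))%N.
  have -> : (2 * k.+1 = (2 * k).+2)%N by lia.
  move: e1 e2; rewrite /= => <- e2.
  have e3 : ((2 * k).+1 - k = k.+1)%N by lia.
  rewrite e3 in e2.
  nia.
have {}e : k.+1%:R * 'C(2 * k.+1, k.+1)%:R
    = 2 * (2 * k%:R + 1) * 'C(2 * k, k)%:R :> rat.
  by rewrite -natrM e !natrM natrD natrM.
by apply: (mulfI k0); rewrite e [RHS]mulrA [_ * (_ / _)]mulrC divfK.
Qed.

(** Since [(a - k) (-1 - a - k) = k (k + 1) - a (a + 1)], the ratio depends on [a] only through
    [m]. *)
Lemma S_termS a k :
  S_term a k.+1 = (k%:R * (k%:R + 1) - a * (a + 1)) * (2 * k%:R + 1)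
                  / (2 * (k%:R + 1) ^+ 3) * S_term a k.
Proof.
rewrite /S_term !qbinomS bin_central_rec exprS -[k.+1]addn1 natrD.
have k0 : k%:R + 1 != 0 :> rat by rewrite natr1 pnatr_eq0.
have f0 : (4 : rat) ^+ k != 0 by rewrite expf_neq0.
by field; rewrite k0 f0.
Qed.

(** Shifting index and parameter together makes the factor [a + 1] from the first binomial cancel
    the [1 / (a + 1)] from the second. The terms for [a + 1] thus become polynomial multiples, in
    [a], of those for [a]. *)
Lemma S_termDS a k : a + 1 != 0 ->
  S_term (a + 1) k.+1 = - (a + 1 + k%:R) * (a + 2 + k%:R) * (2 * k%:R + 1)
                  / (2 * (k%:R + 1) ^+ 3) * S_term a k.
Proof.
move=> a1; rewrite /S_term qbinomDS bin_central_rec exprS.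
have e := qbinom_pred (- 1 - a) k.+1.
have {}e : qbinom (- 1 - (a + 1)) k.+1
    = (a + 2 + k%:R) / (a + 1) * qbinom (- 1 - a) k.+1.
  apply: (mulfI a1); rewrite -[in RHS]mulrA [RHS]mulrCA mulVKf //.
  have -> : - 1 - (a + 1) = - 1 - a - 1 by ring.
  apply: oppr_inj; rewrite -!mulNr.
  have -> : - (a + 1) = - 1 - a by ring.
  rewrite e -[k.+1]addn1 natrD; ring.
rewrite e qbinomS -[k.+1]addn1 natrD.
have k0 : k%:R + 1 != 0 :> rat by rewrite natr1 pnatr_eq0.
have f0 : (4 : rat) ^+ k != 0 by rewrite expf_neq0.
by field; rewrite k0 f0 a1.
Qed.

(** * Indefinite summation identities over the rationals *)

Lemma sum_nat_recr (F : nat -> rat) n :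
  \sum_(0 <= k < n.+1) F k = \sum_(0 <= k < n) F k + F n.
Proof. by rewrite big_nat_recr. Qed.

Lemma S_sumS n a : S_sum n.+1 a = S_sum n a + S_term a n.
Proof. exact: sum_nat_recr. Qed.

(* The Gosper certificate is [-2 k^2 / (a (a + 1 - k)) * t_k], rewritten in terms
   of [t_(k-1)] so that no denominator [a + 1 - k] appears. *)
Lemma sum_contiguous a n : a != 0 -> a + 1 != 0 ->
  \sum_(0 <= k < n.+1) S_term a k / (k + 1)%:R =
  S_sum n.+1 a + (a + 1) / a * S_sum n.+1 (a + 1)
  - (a + 1 + n%:R) * (2 * n%:R + 1) / (a * (n%:R + 1)) * S_term a n.
Proof.
move=> a0 a1; rewrite /S_sum; elim: n => [|n IH].
  by rewrite !big_nat1 !S_term0; field; rewrite a0.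
have n0 : n%:R + 1 != 0 :> rat by rewrite natr1 pnatr_eq0.
have n1 : n%:R + 2 != 0 :> rat by rewrite -natrD pnatr_eq0 addn2.
rewrite big_nat_recr //= IH [in RHS]big_nat_recr //=.
rewrite [\sum_(0 <= i < n.+2) S_term (a + 1) i]big_nat_recr //=.
rewrite S_termDS // S_termS -[n.+1]addn1 !natrD.
field.
have -> : n%:R + 1 + 1 = n%:R + 2 :> rat by ring.
by rewrite ?n0 ?n1 ?a0.
Qed.

(* The coefficients are determined by matching the residues at [k = -1, -2, -3] and
   the growth at infinity in the telescoping equation with certificate
   [2 k^2 (A k + B) / ((k + 1) (k + 2)) * t_k]. *)
Lemma sum_shift3 a n : (a - 1) * (a + 2) != 0 -> (a - 2) * (a + 3) != 0 ->
  let m := a * (a + 1) in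
  let A := (28 - 6 * m) / (15 * (m - 2) * (m - 6)) in
  let B := (44 - 6 * m) / (15 * (m - 2) * (m - 6)) in
  \sum_(0 <= k < n) S_term a k / (k + 3)%:R =
  A * S_sum n a
  + (3 * m - 16) / (15 * (m - 6)) * \sum_(0 <= k < n) S_term a k / (k + 1)%:R
  + 2 * n%:R ^+ 2 * (A * n%:R + B) / ((n%:R + 1) * (n%:R + 2)) * S_term a n.
Proof.
move=> h2 h6 m A B.
have m2 : m - 2 != 0 by rewrite [m - 2](_ : _ = (a - 1) * (a + 2)) // /m; ring.
have m6 : m - 6 != 0 by rewrite [m - 6](_ : _ = (a - 2) * (a + 3)) // /m; ring.
rewrite /S_sum; elim: n => [|n IH].
  by rewrite !big_geq // mulr0n expr2 !(mul0r, mulr0, addr0).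
have n0 : n%:R + 1 != 0 :> rat by rewrite natr1 pnatr_eq0.
have n1 : n%:R + 2 != 0 :> rat by rewrite -natrD pnatr_eq0 addn2.
have n2 : n%:R + 3 != 0 :> rat by rewrite -natrD pnatr_eq0 addn3.
rewrite big_nat_recr //= IH !big_nat_recr //= S_termS -/m.
rewrite -[n.+1]addn1 !natrD /A /B.
field.
have -> : n%:R + 1 + 1 = n%:R + 2 :> rat by ring.
have -> : n%:R + 1 + 2 = n%:R + 3 :> rat by ring.
by rewrite ?n0 ?n1 ?n2 ?m2 ?m6.
Qed.

(** * Arithmetic of the local ring [Z_p] *)

Lemma Gauss_dvdz_prime (p : nat) (m n : int) : prime p ->
  (p %| m * n)%Z = (p %| m)%Z || (p %| n)%Z.
Proof. by move=> pp; rewrite !dvdzE abszM Euclid_dvdM. Qed.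

(** Lets membership be checked on any fraction, reduced or not: if [p] divided [denq x],
    cross-multiplication would make it divide [numq x] too, against coprimality. *)
Lemma in_Zp_frac (p : nat) (n d : int) : prime p -> ~~ (p %| d)%Z ->
  in_Zp p (n%:~R / d%:~R).
Proof.
move=> pp pd; have d0 : d != 0 by apply: contraNneq pd => ->; rewrite dvdz0.
set x := _ / _; apply/negP => px.
have e : numq x * d = n * denq x.
  apply/eqP; rewrite -(eqr_int rat) !intrM numqE /x mulrAC divfK ?intr_eq0 //.
have : (p %| numq x * d)%Z by rewrite e dvdz_mull // dvdzE.
rewrite Gauss_dvdz_prime // (negPf pd) orbF dvdzE => pn.
have := coprime_num_den x; rewrite /coprime => /eqP g1.
have : (p %| gcdn `|numq x| `|denq x|)%N by rewrite dvdn_gcd pn.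
by rewrite g1 dvdn1 => /eqP p1; rewrite p1 in pp.
Qed.

Lemma in_ZpP (p : nat) (x : rat) : in_Zp p x ->
  exists n d : int, x = n%:~R / d%:~R /\ ~~ (p %| d)%Z.
Proof.
by move=> px; exists (numq x), (denq x); rewrite divq_num_den dvdzE.
Qed.

Lemma in_Zp_int p (n : int) : prime p -> in_Zp p n%:~R.
Proof.
move=> pp; rewrite -[n%:~R]divr1 -[1]/(1%:~R); apply: in_Zp_frac => //.
by rewrite dvdzE /= dvdn1; case: p pp => [|[]].
Qed.

Lemma in_Zp_nat p n : prime p -> in_Zp p n%:R.
Proof. exact: (in_Zp_int p n). Qed.

Lemma in_ZpD p x y : prime p -> in_Zp p x -> in_Zp p y -> in_Zp p (x + y).
Proof.
move=> pp /in_ZpP[n [d [-> pd]]] /in_ZpP[n' [d' [-> pd']]].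
have nz (e : int) : ~~ (p %| e)%Z -> e%:~R != 0 :> rat.
  by rewrite intr_eq0; apply: contraNneq => ->; rewrite dvdz0.
rewrite addf_div ?nz // -!intrM -intrD.
by apply: in_Zp_frac; rewrite // Gauss_dvdz_prime // negb_or pd.
Qed.

Lemma in_ZpM p x y : prime p -> in_Zp p x -> in_Zp p y -> in_Zp p (x * y).
Proof.
move=> pp /in_ZpP[n [d [-> pd]]] /in_ZpP[n' [d' [-> pd']]].
rewrite mulf_div -!intrM.
by apply: in_Zp_frac; rewrite // Gauss_dvdz_prime // negb_or pd.
Qed.

Lemma in_ZpN p x : in_Zp p (- x) = in_Zp p x.
Proof. by rewrite /in_Zp denqN. Qed.

Lemma in_ZpB p x y : prime p -> in_Zp p x -> in_Zp p y -> in_Zp p (x - y).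
Proof. by move=> pp px py; rewrite in_ZpD ?in_ZpN. Qed.

Lemma in_Zp_prod p n (F : 'I_n -> rat) (P : pred 'I_n) : prime p ->
  (forall i, in_Zp p (F i)) -> in_Zp p (\prod_(i < n | P i) F i).
Proof.
move=> pp pF; apply: (big_ind (in_Zp p)) => [|x y|i _] //.
  exact: (in_Zp_nat p 1).
exact: in_ZpM.
Qed.

(** Outside [p Z_p] the numerator is prime to [p], so the inverted fraction is again admissible. *)
Lemma in_ZpV p x : prime p -> in_Zp p x -> ~~ in_Zp p (x / p%:R) ->
  in_Zp p x^-1.
Proof.
move=> pp /in_ZpP[n [d [-> pd]]]; have [/dvdzP[k ->]|pn _] := boolP (p %| n)%Z.
  have p0 : p%:R != 0 :> rat by rewrite pnatr_eq0 -lt0n prime_gt0.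
  by rewrite intrM mulrAC mulrK ?unitfE // in_Zp_frac.
by rewrite invf_div in_Zp_frac.
Qed.

Lemma in_Zp_natV p n : prime p -> ~~ (p %| n)%N -> in_Zp p n%:R^-1.
Proof.
by move=> pp pn; rewrite -[_^-1]mul1r; exact: (in_Zp_frac p 1 n).
Qed.

Lemma in_Zp_residue p x : prime p -> in_Zp p x ->
  exists2 r, (r < p)%N & in_Zp p ((x - r%:R) / p%:R).
Proof.
move=> pp /in_ZpP[n [d [-> pd]]].
have p0 : p%:R != 0 :> rat by rewrite pnatr_eq0 -lt0n prime_gt0.
have d0 : d%:~R != 0 :> rat.
  by rewrite intr_eq0; apply: contraNneq pd => ->; rewrite dvdz0.
(* The Bezout coefficient [u] inverts [d] modulo [p], so the residue of [n / d] is [n * u] reduced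
   modulo [p]. *)
have /coprimezP[[u v] /= e] : coprimez d p.
  by rewrite coprimezE coprime_sym prime_coprime // -dvdzE.
have pz : p%:Z != 0 by rewrite -(intr_eq0 rat).
have r0 := modz_ge0 (n * u) pz.
exists `|(n * u %% p)%Z|%N.
  by rewrite -ltz_nat gez0_abs // ltz_pmod // ltz_nat prime_gt0.
set r := `|_|%N.
have er : n * u = (n * u %/ p)%Z * p + r by rewrite /r gez0_abs // -divz_eq.
set q := (n * u %/ p)%Z in er.
have en : n - r%:Z * d = (q * d + n * v) * p.
  by rewrite -[n in LHS]mulr1 -e mulrDr mulrA er; ring.
rewrite (_ : _ / _ = (q * d + n * v)%:~R / d%:~R) ?in_Zp_frac //.
have := congr1 (fun z : int => z%:~R : rat) en.
rewrite rmorphB !rmorphM /= => en'.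
have -> : n%:~R / d%:~R - r%:R = (n%:~R - r%:R * d%:~R) / d%:~R :> rat by field.
by rewrite en'; field; rewrite d0 p0.
Qed.

(** * Divisibility of the summands by powers of [p] *)

Lemma prime_dvd_fact p n : prime p -> (p %| n`!)%N = (p <= n)%N.
Proof.
move=> pp; apply/idP/idP => [|pn]; last by rewrite dvdn_fact ?prime_gt0.
elim: n => [|n IH]; first by rewrite fact0 dvdn1 => /eqP p1; rewrite p1 in pp.
rewrite factS Euclid_dvdM // => /orP[/dvdn_leq|/IH]; first exact.
exact: leqW.
Qed.

Lemma in_Zp_qbinom p b k : prime p -> in_Zp p b -> (k < p)%N ->
  in_Zp p (qbinom b k).
Proof.
move=> pp pb kp; rewrite /qbinom in_ZpM //.
  by apply: in_Zp_prod => // i; rewrite in_ZpB // in_Zp_nat.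
by rewrite in_Zp_natV // prime_dvd_fact // -ltnNge.
Qed.

(* The residue [r < p] of [b] satisfies [r < k], so the factor [b - r] occurs
   in the numerator. *)
Lemma qbinom_dvdp p b k : prime p -> in_Zp p b -> (k < p)%N ->
  (forall j, (0 < j <= p - k)%N -> ~~ in_Zp p ((b + j%:R) / p%:R)) ->
  in_Zp p (qbinom b k / p%:R).
Proof.
move=> pp pb kp nb; have [r rp pr] := in_Zp_residue p b pp pb.
have p0 : p%:R != 0 :> rat by rewrite pnatr_eq0 -lt0n prime_gt0.
have rk : (r < k)%N.
  rewrite ltnNge; apply/negP => kr.
  (* If [k <= r], then [j = p - r] lies in the excluded range, while [b + j = (b - r) + p] is
     divisible by [p]. *)
  have /negP[] := nb (p - r)%N ltac:(lia).
  rewrite natrB ?(ltnW rp) // (_ : _ / _ = (b - r%:R) / p%:R + 1%:R).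
    by rewrite in_ZpD // in_Zp_nat.
  by field.
rewrite /qbinom (bigD1 (Ordinal rk)) //=.
rewrite [X in in_Zp p X](_ : _ = (b - r%:R) / p%:R
  * \prod_(i < k | i != Ordinal rk) (b - i%:R) * (k`!%:R)^-1); last by ring.
apply: in_ZpM => //; first apply: in_ZpM => //.
- by apply: in_Zp_prod => // i; rewrite in_ZpB // in_Zp_nat.
- by rewrite in_Zp_natV // prime_dvd_fact // -ltnNge.
Qed.

(** The prime [p] divides [(2 k)!] but not [k!]. *)
Lemma bin_central_dvdp p k : prime p -> (k < p)%N -> (p <= 2 * k)%N ->
  (p %| 'C(2 * k, k))%N.
Proof.
move=> pp kp pk; have e := @bin_fact (2 * k) k ltac:(lia).
have : (p %| 'C(2 * k, k) * (k`! * (2 * k - k)`!))%N by rewrite e prime_dvd_fact.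
rewrite !Euclid_dvdM // !prime_dvd_fact // (_ : 2 * k - k = k)%N; last lia.
by rewrite leqNgt kp !orbF.
Qed.

Lemma S_term_dvdp3 p a k : prime p -> (2 < p)%N -> in_Zp p a ->
  (k < p)%N -> (p <= 2 * k)%N ->
  (forall j, (0 < j <= p - k)%N -> ~~ in_Zp p ((a + j%:R) / p%:R)) ->
  (forall j, (j < p - k)%N -> ~~ in_Zp p ((a - j%:R) / p%:R)) ->
  in_Zp p (S_term a k / p%:R ^+ 3).
Proof.
move=> pp p2 pa kp pk n1 n2.
have p0 : p%:R != 0 :> rat by rewrite pnatr_eq0 -lt0n prime_gt0.
have f0 : (4 : rat) ^+ k != 0 by rewrite expf_neq0.
have -> : S_term a k / p%:R ^+ 3 = (qbinom a k / p%:R)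
   * (qbinom (- 1 - a) k / p%:R) * ('C(2 * k, k)%:R / p%:R) * (4 ^+ k)^-1.
  by rewrite /S_term; field; rewrite f0 p0.
apply: in_ZpM => //; first (apply: in_ZpM => //; first apply: in_ZpM => //).
- exact: qbinom_dvdp.
- apply: qbinom_dvdp => //.
  by rewrite in_ZpB // -[- 1]/((-1)%:~R) in_Zp_int.
  (* The condition on [-1 - a] becomes one on [a] because [-1 - a + (j + 1) = -(a - j)]. *)
  case=> // j jk; rewrite -in_ZpN -mulNr -natr1.
  rewrite (_ : - (_ + _) = a - j%:R); last by ring.
  by apply: n2; lia.
- have /dvdnP[c ->] := bin_central_dvdp p k pp kp pk.
  by rewrite natrM mulfK // in_Zp_nat.
- rewrite -natrX in_Zp_natV // Euclid_dvdX // (_ : 4 = 2 * 2)%N //.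
  rewrite Euclid_dvdM // orbb dvdn_prime2 //; lia.
Qed.

(** * Assembly of the congruences modulo [p ^ 3] *)

Lemma in_Zp_lin3 p (c0 c1 c2 t0 t1 t2 q : rat) : prime p ->
  in_Zp p c0 -> in_Zp p c1 -> in_Zp p c2 ->
  in_Zp p (t0 / q) -> in_Zp p (t1 / q) -> in_Zp p (t2 / q) ->
  in_Zp p ((c0 * t0 + c1 * t1 + c2 * t2) / q).
Proof.
move=> pp c0p c1p c2p t0p t1p t2p; rewrite !mulrDl -!mulrA.
by apply: in_ZpD => //; [apply: in_ZpD => //|]; apply: in_ZpM.
Qed.

Lemma congZp_euclidean p r x y z : prime p ->
  congZp p r x z -> congZp p r y z -> congZp p r x y.
Proof.
move=> pp xz yz; rewrite /congZp -[x - y](subrKA z) -[z - y]opprB mulrBl.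
exact: in_ZpB.
Qed.

Ltac in_Zp_tac :=
  try assumption;
  lazymatch goal with
  | |- is_true (in_Zp _ (GRing.add _ _)) => apply: in_ZpD; in_Zp_tac
  | |- is_true (in_Zp _ (GRing.mul _ _)) => apply: in_ZpM; in_Zp_tac
  | |- is_true (in_Zp _ (GRing.opp _)) => rewrite in_ZpN; in_Zp_tac
  | |- is_true (in_Zp _ (GRing.exp _ _)) => rewrite exprS; in_Zp_tac
  | |- is_true (in_Zp _ (GRing.natmul _ _)) => exact: in_Zp_nat
  | |- is_true (in_Zp _ (GRing.one _)) => exact: (in_Zp_nat _ 1)
  | |- _ => idtac
  end.

Theorem theorem11p1 (p : nat) (a : rat)
  (p_prime : prime p) (p_gt5 : (5 < p)%N)
  (aZp : in_Zp p a)
  (a_neq0 : ~~ congZp p 1 a 0)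
  (a_neq1 : ~~ congZp p 1 a 1)
  (a_neqN1 : ~~ congZp p 1 a (- 1))
  (a_neq2 : ~~ congZp p 1 a 2)
  (a_neqN2 : ~~ congZp p 1 a (- 2))
  (a_neqN3 : ~~ congZp p 1 a (- 3)) :
  let lhs := \sum_(0 <= k < (p - 3)%N) S_term a k / (k + 3)%:R in
  let mid :=
    (3 * a * (a + 1) - 10) / (15 * (a - 1) * (a + 2)) * S_sum p a
    + (a + 1) * (3 * a * (a + 1) - 16) / (15 * a * (a - 2) * (a + 3))
      * S_sum p (a + 1) in
  let rhs :=
    (28 - 6 * a * (a + 1)) / (15 * (a - 1) * (a ^+ 2 - 4) * (a + 3))
      * S_sum p a
    + (3 * a * (a + 1) - 16) / (15 * (a - 2) * (a + 3))
      * \sum_(0 <= k < (p - 1)%N) S_term a k / (k + 1)%:R in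
  congZp p 3 lhs mid /\ congZp p 3 mid rhs.
Proof.
move=> lhs mid rhs.
(* Each excluded residue [c] makes [a - c] a unit of [Z_p]. *)
have unit_subr c : in_Zp p c -> ~~ congZp p 1 a c ->
    (a - c != 0) * in_Zp p (a - c)^-1.
  move=> pc nac; split; last by rewrite in_ZpV // in_ZpB.
  apply: contra nac => /eqP e; rewrite /congZp e mul0r.
  exact: (in_Zp_nat p 0).
have Zn k : in_Zp p k%:R by exact: in_Zp_nat.
have [a0 v0] := unit_subr 0 (Zn 0) a_neq0.
have [a1 v1] := unit_subr 1 (Zn 1) a_neq1.
have [a2 v2] := unit_subr 2 (Zn 2) a_neq2.
have ZnN k : in_Zp p (- k%:R) by rewrite in_ZpN.
have [b1 w1] := unit_subr (- 1) (ZnN 1) a_neqN1.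
have [b2 w2] := unit_subr (- 2) (ZnN 2) a_neqN2.
have [b3 w3] := unit_subr (- 3) (ZnN 3) a_neqN3.
rewrite subr0 in a0 v0; rewrite !opprK in b1 w1 b2 w2 b3 w3.
have aD1Zp : in_Zp p (a + 1) by rewrite in_ZpD // (Zn 1).
have nat_unit k : (0 < k < p)%N -> in_Zp p k%:R^-1.
  by case/andP => k0 kp; rewrite in_Zp_natV // gtnNdvd.
have [n pn] : exists n, p = n.+3 by exists (p - 3)%N; clear -p_gt5; lia.
(* For [k >= p - 3] the offsets are [1, 2, 3] for [a + j] and [0, 1, 2] for [a - j]: exactly the six
   excluded residues. *)
have T3 k : (n <= k < p)%N -> in_Zp p (S_term a k / p%:R ^+ 3).
  case/andP => nk kp; apply: S_term_dvdp3 => //; try by clear -p_gt5 pn nk; lia.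
    move=> j jp.
    have : (j = 1 \/ j = 2 \/ j = 3)%N by clear -pn jp nk; lia.
    by case=> [|[|]] ->; [move: a_neqN1|move: a_neqN2|move: a_neqN3];
      rewrite /congZp opprK.
  move=> j jp.
  have : (j = 0 \/ j = 1 \/ j = 2)%N by clear -pn jp nk; lia.
  by case=> [|[|]] ->.
(* For [a + 1] only [k = p - 1] matters; it requires that [p] divide neither [a + 2] nor [a + 1]. *)
have U3 : in_Zp p (S_term (a + 1) n.+2 / p%:R ^+ 3).
  apply: S_term_dvdp3 => //; try by clear -p_gt5 pn; lia.
    move=> j jp; have -> : j = 1%N by clear -pn jp; lia.
    by move: a_neqN2; rewrite /congZp opprK -addrA.
  move=> j jp; have -> : j = 0%N by clear -pn jp; lia.
  by move: a_neqN1; rewrite /congZp opprK subr0.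
have T0 : in_Zp p (S_term a n / p%:R ^+ 3) by apply: T3; clear -pn; lia.
have T1 : in_Zp p (S_term a n.+1 / p%:R ^+ 3) by apply: T3; clear -pn; lia.
have T2 : in_Zp p (S_term a n.+2 / p%:R ^+ 3) by apply: T3; clear -pn; lia.
have n1 : n%:R + 1 != 0 :> rat by rewrite natr1 pnatr_eq0.
have n2 : n%:R + 2 != 0 :> rat by rewrite -natrD pnatr_eq0 addn2.
have u1 : in_Zp p (n%:R + 1)^-1 by rewrite natr1 nat_unit // pn; clear; lia.
have u2 : in_Zp p (n%:R + 2)^-1 by rewrite -natrD nat_unit // pn; clear; lia.
have u15 : in_Zp p 15^-1.
  rewrite (_ : 15 = 3 * 5)%N // natrM invfM.
  by apply: in_ZpM => //; apply: nat_unit; clear -p_gt5; lia.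
have m2 : in_Zp p (a * (a + 1) - 2)^-1.
  by rewrite (_ : _ - 2 = (a - 1) * (a + 2)) ?invfM ?in_ZpM //; ring.
have m6 : in_Zp p (a * (a + 1) - 6)^-1.
  by rewrite (_ : _ - 6 = (a - 2) * (a + 3)) ?invfM ?in_ZpM //; ring.
have m20 : a * (a + 1) - 2 != 0.
  by rewrite (_ : _ - 2 = (a - 1) * (a + 2)) ?mulf_neq0 //; ring.
have m60 : a * (a + 1) - 6 != 0.
  by rewrite (_ : _ - 6 = (a - 2) * (a + 3)) ?mulf_neq0 //; ring.
(* [A], [B], [C] are the coefficients of [sum_shift3], with the inverses split so that each factor
   is visibly in [Z_p]. *)
pose A := (28 - 6 * (a * (a + 1)))
  * (15^-1 * (a * (a + 1) - 2)^-1 * (a * (a + 1) - 6)^-1).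
pose B := (44 - 6 * (a * (a + 1)))
  * (15^-1 * (a * (a + 1) - 2)^-1 * (a * (a + 1) - 6)^-1).
pose C := (3 * (a * (a + 1)) - 16) * (15^-1 * (a * (a + 1) - 6)^-1).
have ZA : in_Zp p A.
  by rewrite /A; in_Zp_tac.
have ZB : in_Zp p B.
  by rewrite /B; in_Zp_tac.
have ZC : in_Zp p C.
  by rewrite /C; in_Zp_tac.
have a24 : a ^+ 2 - 4 != 0.
  by rewrite (_ : _ - 4 = (a - 2) * (a + 2)) ?mulf_neq0 //; ring.
have rhsE : rhs = A * S_sum p a
    + C * \sum_(0 <= k < (p - 1)%N) S_term a k / (k + 1)%:R.
  have eA : (28 - 6 * a * (a + 1)) / (15 * (a - 1) * (a ^+ 2 - 4) * (a + 3)) = A.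
    by rewrite /A; field; rewrite m20 m60 a1 b3 a24.
  have eC : (3 * a * (a + 1) - 16) / (15 * (a - 2) * (a + 3)) = C.
    by rewrite /C; field; rewrite m60 a2 b3.
  by rewrite /rhs eA eC.
(* The coefficient of [S_sum p a] in [mid] is [A + C]. [sum_contiguous] covers [p - 1] terms, so the
   last terms of both [S_p] sums remain besides its boundary term. *)
have mid_rhs : mid - rhs = C * ((a + 1) / a) * S_term (a + 1) n.+2
   + C * S_term a n.+2
   + C * ((a + 2 + n%:R) * (2 * n%:R + 3) * a^-1 * (n%:R + 2)^-1) * S_term a n.+1.
  rewrite /mid /rhs /C pn (_ : n.+3 - 1 = n.+2)%N; last by clear; lia.
  rewrite sum_contiguous // !(S_sumS n.+2) -(natr1 n); field.
  by rewrite ?n2 ?a0 ?m60 ?b3 ?a2 ?a24 ?a1 ?b2.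
(* [sum_shift3] stops at [n = p - 3], whereas the sums in [rhs] run to [p] and [p - 1]; the surplus
   terms join the boundary term at [n]. *)
have lhs_rhs : lhs - rhs =
   (2 * (n%:R * n%:R) * (A * n%:R + B) * ((n%:R + 1)^-1 * (n%:R + 2)^-1)
     - A - C * (n%:R + 1)^-1) * S_term a n
   + (- A - C * (n%:R + 2)^-1) * S_term a n.+1 + - A * S_term a n.+2.
  rewrite rhsE /lhs pn (_ : n.+3 - 1 = n.+2)%N; last by clear; lia.
  rewrite (_ : n.+3 - 3 = n)%N; last by clear; lia.
  rewrite sum_shift3 ?mulf_neq0 // !invfM -/A -/B -/C.
  rewrite !S_sumS !sum_nat_recr.
  rewrite (natrD _ n 1) (natrD _ n.+1 1) -(natr1 n).
  rewrite (_ : n%:R + 1 + 1 = n%:R + 2); last by ring.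
  clearbody A B C.
  move: (S_sum n a) (S_term a n) (S_term a n.+1) (S_term a n.+2).
  move: (\sum_(0 <= k < n) _) (n%:R + 1)^-1 (n%:R + 2)^-1; move: n%:R.
  move=> x L y1 y2 s t0 t1 t2; ring.
have mid_rhsZp : congZp p 3 mid rhs.
  by rewrite /congZp mid_rhs; apply: in_Zp_lin3; in_Zp_tac.
have lhs_rhsZp : congZp p 3 lhs rhs.
  by rewrite /congZp lhs_rhs; apply: in_Zp_lin3; in_Zp_tac.
(* The first congruence goes through [rhs], to which both [lhs] and [mid] are congruent. *)
by split; first exact: (congZp_euclidean _ _ _ _ rhs p_prime lhs_rhsZp mid_rhsZp).
Qed.
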